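(* Let $J(\cdot),H(\cdot)$ be absolutely one-homogeneous functionals. If the sequence $\{u^k\}$ defined by the fully implicit scheme $$u^{k+1}=\arg\min_u\left\{\frac{\beta}{2}\|u-u^k\|_2^2-\frac{R(u^k)}{H(u)}\langle q^k,u\rangle+R(u)+\frac{\lambda}{2}\|Au-f\|_2^2\right\}$$ is uniformly bounded, then there exists a subsequence of $(u^k,p^k,q^k)$ that converges to some $(u^*,p^*,q^* )$. Moreover, $$p^*\in\partial J(u^* ),\qquad q^*\in\partial H(u^* ),\qquad\text{and}\qquad 0=\lambda A^T(Au^*-f)+\frac{p^*-R(u^* )q^*}{H(u^* )}.$$
   Context: $\Omega\subset\mathbb R^n$ is a proper domain, over which $u$ ranges. A functional $F:\Omega\to\mathbb R$ is absolutely one-homogeneous if $F(\alpha u)=|\alpha|F(u)$ for all $\alpha\in\mathbb R$, $u\in\Omega$. The functionals $J,H$ are proper, convex and lower semi-continuous on $\Omega$. The quotient is $R(u):=J(u)/H(u)$, with the convention $\frac{J(0)}{H(0)}:=0$. $A$ is a linear operator (a real matrix with $n$ columns), $f$ is the given data vector, and $\lambda>0$, $\beta>0$ are constants. $\partial$ denotes the convex subdifferential, $\partial F(u)=\{p: F(v)\ge F(u)+\langle p,v-u\rangle\ \ \forall v\in\Omega\}$, and $p^k\in\partial J(u^k)$, $q^k\in\partial H(u^k)$ are subgradients at the iterates. $\|\cdot\|_2$ is the Euclidean norm and $\langle\cdot,\cdot\rangle$ the Euclidean inner product.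
   Formalization: The p^k are suitable subgradients of J at u^k shown to exist, not arbitrary ones; the convergent subsequence is of (u^k, p^{k+1}, q^k), with u^{k+1} also tending to u^*; the final equation, with H(u^* ) nonzero, is claimed only when H(u^k) does not tend to 0. *)

(* Defs.v *)
From HB Require Import structures.
From mathcomp Require Import all_boot all_order all_algebra.
From mathcomp Require Import all_classical all_reals all_analysis.

Set Implicit Arguments.
Unset Strict Implicit.
Unset Printing Implicit Defensive.

Import Order.TTheory GRing.Theory Num.Theory.
Import numFieldNormedType.Exports.

Local Open Scope classical_set_scope.
Local Open Scope ring_scope.

Definition dotv (R : realType) (n : nat) (u v : 'cV[R]_n) : R :=
  \sum_(i < n) u i 0 * v i 0.

(* The library norm `|u| on 'cV[R]_n is the sup norm. *)
Definition norm2 (R : realType) (n : nat) (u : 'cV[R]_n) : R :=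
  Num.sqrt (dotv u u).

Definition domain (T : topologicalType) (Omega : set T) : Prop :=
  [/\ open Omega, connected Omega & Omega !=set0].

(* A functional F : Omega -> R is represented by a total function of which
   only the values on Omega are ever used.  Being real-valued on a nonempty
   set, such a functional is proper. *)

(* F (a *: u) only makes sense when a *: u lies in Omega. *)
Definition abs_one_homogeneous (R : realType) (n : nat) (Omega : set 'cV[R]_n)
    (F : 'cV[R]_n -> R) : Prop :=
  forall (a : R) (u : 'cV[R]_n), Omega u ->
    Omega (a *: u) /\ F (a *: u) = `|a| * F u.

Definition convex_on (R : realType) (n : nat) (Omega : set 'cV[R]_n)
    (F : 'cV[R]_n -> R) : Prop :=
  convex_set Omega /\ convex_function Omega F.

Definition lsc_on (R : realType) (n : nat) (Omega : set 'cV[R]_n)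
    (F : 'cV[R]_n -> R) : Prop :=
  lower_semicontinuous (fun u : subspace Omega => (F u)%:E).

Definition subdifferential (R : realType) (n : nat) (Omega : set 'cV[R]_n)
    (F : 'cV[R]_n -> R) (u : 'cV[R]_n) : set 'cV[R]_n :=
  [set p | forall v, Omega v -> F u + dotv p (v - u) <= F v].

Definition quotient (R : realType) (n : nat) (J H : 'cV[R]_n -> R)
    (u : 'cV[R]_n) : R :=
  if u == 0 then 0 else J u / H u.

(* The points at which the quotient is meaningful.  This keeps the library
   value x / 0 = 0 out of the minimisation: a nonzero u with H u = 0 does not
   compete. *)
Definition admissible (R : realType) (n : nat) (Omega : set 'cV[R]_n)
    (H : 'cV[R]_n -> R) : set 'cV[R]_n :=
  [set u | Omega u /\ (u = 0 \/ H u != 0)].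

(* On admissible points the division by H u is a junk division only at u = 0,
   where <q, u> = 0: the second term is then 0, in line with the value 0 of
   the quotient there. *)
Definition objective (R : realType) (m n : nat) (J H : 'cV[R]_n -> R)
    (A : 'M[R]_(m, n)) (f : 'cV[R]_m) (lambda beta : R)
    (w q u : 'cV[R]_n) : R :=
  beta / 2 * norm2 (u - w) ^+ 2
  - quotient J H w / H u * dotv q u
  + quotient J H u
  + lambda / 2 * norm2 (A *m u - f) ^+ 2.

Definition is_argmin (R : realType) (T : Type) (S : set T) (g : T -> R)
    (x : T) : Prop :=
  S x /\ forall y, S y -> g x <= g y.

(* The minimiser need not be unique; u k.+1 is any one of them, and q k is any
   subgradient of H at u k. *)
Definition implicit_scheme (R : realType) (m n : nat) (Omega : set 'cV[R]_n)
    (J H : 'cV[R]_n -> R) (A : 'M[R]_(m, n)) (f : 'cV[R]_m) (lambda beta : R)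
    (u q : nat -> 'cV[R]_n) : Prop :=
  [/\ admissible Omega H (u 0%N),
      forall k, subdifferential Omega H (u k) (q k)
    & forall k, is_argmin (admissible Omega H)
                  (objective J H A f lambda beta (u k) (q k)) (u k.+1)].

(* Main.v *)
Require Import Defs.
From HB Require Import structures.
From mathcomp Require Import all_boot all_order all_algebra ring lra.
From mathcomp Require Import all_classical all_reals all_analysis.

Set Implicit Arguments.
Unset Strict Implicit.
Unset Printing Implicit Defensive.

Import Order.TTheory GRing.Theory Num.Theory.
Import numFieldNormedType.Exports.

Local Open Scope classical_set_scope.
Local Open Scope ring_scope.

(** A nonempty open set that is stable under all scalings is the whole space, so
    J and H are finite seminorms on it: they are continuous, and their
    subgradients are uniformly bounded ([subgradient_coord_le]).

    Comparing the minimiser u k.+1 with the candidate u k shows that the energy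
    R(u k) + lambda/2 |A u k - f|^2 decreases by at least
    beta/2 |u k.+1 - u k|^2 ([objective_descent]).  The energy is nonnegative, so
    the increments of u tend to 0 ([iterates_gap]).

    The quotient is neither convex nor smooth, but its stationarity condition is
    the expected one ([minimiser_optimality]): writing w = u k, x = u k.+1,
    a = R(w) q k, s = (J x - <a, x>) / H x and g for the gradient at x of the two
    quadratic terms, there are p in the subdifferential of J at x and h in that
    of H at x with p = a + s h - H(x) g.  The subgradients p of J are those
    produced here.  When s < 0 they come from splitting a subgradient of
    J + |s| H by the Moreau-Rockafellar sum rule, which rests on the
    finite-dimensional Hahn-Banach theorem ([mazur_orlicz]).

    All the sequences u, p, q, h being bounded, a common subsequence converges,
    and subdifferentials are closed under limits.  If H (u k) does not tend to 0,
    the subsequence can be taken with H (u k) bounded away from 0, which gives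
    H ustar != 0.  Then s tends to (J ustar - R(ustar) <qstar, ustar>) / H ustar,
    which is 0 because <qstar, ustar> = H ustar; the extra term s h disappears,
    and dividing the limit equation by H ustar concludes
    ([optimality_limit]). *)

(** * The Euclidean inner product *)

Section Dotv.
Context {R : realType} {n : nat}.
Implicit Types (u v w : 'cV[R]_n) (a : R).

Lemma dotvC u v : dotv u v = dotv v u.
Proof. by apply: eq_bigr => i _; rewrite mulrC. Qed.

Lemma dotvDr u v w : dotv u (v + w) = dotv u v + dotv u w.
Proof. by rewrite -big_split; apply: eq_bigr => i _; rewrite mxE mulrDr. Qed.

Lemma dotvZr a u v : dotv u (a *: v) = a * dotv u v.
Proof. by rewrite mulr_sumr; apply: eq_bigr => i _; rewrite mxE mulrCA. Qed.

Lemma dotvNr u v : dotv u (- v) = - dotv u v.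
Proof. by rewrite -scaleN1r dotvZr mulN1r. Qed.

Lemma dotv0 u : dotv u 0 = 0.
Proof. by rewrite -(scale0r 0) dotvZr mul0r. Qed.

Lemma dotvDl u v w : dotv (u + v) w = dotv u w + dotv v w.
Proof. by rewrite !(dotvC _ w) dotvDr. Qed.

Lemma dotvZl a u v : dotv (a *: u) v = a * dotv u v.
Proof. by rewrite !(dotvC _ v) dotvZr. Qed.

Lemma dotvNl u v : dotv (- u) v = - dotv u v.
Proof. by rewrite !(dotvC _ v) dotvNr. Qed.

Lemma norm2_sqr u : norm2 u ^+ 2 = dotv u u.
Proof. by rewrite sqr_sqrtr// sumr_ge0// => i _; rewrite -expr2 sqr_ge0. Qed.

Lemma dotv_delta u i : dotv u (delta_mx i 0) = u i 0.
Proof.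
rewrite /dotv (bigD1 i)//= !mxE !eqxx mulr1 big1 ?addr0// => j /negPf ji.
by rewrite mxE ji mulr0.
Qed.

Lemma col_sum_delta v : v = \sum_(i < n) v i 0 *: delta_mx i 0.
Proof.
apply/matrixP => i j; rewrite ord1 summxE (bigD1 i)//= !mxE !eqxx mulr1.
rewrite big1 ?addr0// => k /negPf ki.
by rewrite !mxE eq_sym ki mulr0.
Qed.

Lemma coord_le_norm2 u i : `|u i 0| <= norm2 u.
Proof.
rewrite -sqrtr_sqr ler_sqrt ?sumr_ge0//; last first.
  by move=> j _; rewrite -expr2 sqr_ge0.
rewrite /dotv (bigD1 i)//= -expr2 lerDl sumr_ge0// => j _.
by rewrite -expr2 sqr_ge0.
Qed.

End Dotv.

Lemma dotv_trmx {R : realType} {m n : nat} (A : 'M[R]_(m, n)) w u :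
  dotv (A^T *m w) u = dotv w (A *m u).
Proof.
have E k (a b : 'cV[R]_k) : dotv a b = (a^T *m b) 0 0.
  by rewrite mxE; apply: eq_bigr => i _; rewrite mxE.
by rewrite !E trmx_mul trmxK mulmxA.
Qed.

(** * Linear minorants of sublinear functions *)

Definition sublinear {R : realType} {V : lmodType R} (N : V -> R) :=
  (forall u v, N (u + v) <= N u + N v) /\
  (forall t v, 0 <= t -> N (t *: v) = t * N v).

(** K y a stands for a lower bound a <= p y imposed on a linear p <= N.  Such
    bounds can be added and scaled, so the natural sets of them are convex
    cones; a <= N y is the obvious necessary condition. *)
Definition minorant_cone {R : realType} {V : lmodType R} (N : V -> R)
    (K : V -> R -> Prop) :=
  [/\ K 0 0,
      forall y a z b, K y a -> K z b -> K (y + z) (a + b),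
      forall t y a, 0 < t -> K y a -> K (t *: y) (t * a)
    & forall y a, K y a -> a <= N y].

Section Shrink.
Context {R : realType} {V : lmodType R} (N : V -> R) (K : V -> R -> Prop).
Hypotheses (sN : sublinear N) (cK : minorant_cone N K).

Let values v := [set r | exists y a, K y a /\ r = N (v + y) - a].
Let M v := inf (values v).

Let values_lb v : lbound (values v) (- N (- v)).
Proof.
case: cK => _ _ _ KN r [y [a [Kya ->]]].
have := KN _ _ Kya; have := sN.1 (v + y) (- v); rewrite addrAC subrr add0r.
lra.
Qed.

Let M_le v y a : K y a -> M v <= N (v + y) - a.
Proof.
move=> Kya; apply: ge_inf; last by exists y, a.
by exists (- N (- v)); exact: values_lb.
Qed.

Let le_M v b : (forall y a, K y a -> b <= N (v + y) - a) -> b <= M v.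
Proof.
move=> H; apply: lb_le_inf.
  by case: cK => K0 _ _ _; exists (N (v + 0) - 0), 0, 0.
by move=> r [y [a [Kya ->]]]; exact: H.
Qed.

Let M_scale_le t v : 0 < t -> M (t *: v) <= t * M v.
Proof.
move=> t0; rewrite -ler_pdivrMl//; apply: le_M => y a Kya.
rewrite ler_pdivrMl// mulrBr -(sN.2 _ _ (ltW t0)) scalerDr.
by apply: M_le; case: cK => _ _ KZ _; exact: KZ.
Qed.

(** The inf-convolution M v = inf (N (v + y) - a) over the cone turns the
    constraints into an upper bound: a linear p <= M satisfies
    - p y = p (- y) <= - a. *)
Lemma sublinear_shrink : exists M : V -> R,
  [/\ sublinear M, forall v, M v <= N v & forall y a, K y a -> M (- y) <= - a].
Proof.
have N0 : N 0 = 0 by rewrite -(scale0r 0) sN.2// mul0r.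
case: (cK) => K0 KD _ _.
exists M; split; first split.
- move=> u v; rewrite -lerBlDr; apply: le_M => y a Kya.
  rewrite lerBlDr -lerBlDl; apply: le_M => z b Kzb.
  rewrite lerBlDl (le_trans (M_le _ (KD _ _ _ _ Kya Kzb)))//.
  have := sN.1 (u + y) (v + z); rewrite addrACA; lra.
- move=> t v; rewrite le_eqVlt => /predU1P[<-|t0].
    rewrite scale0r mul0r; apply/eqP; rewrite eq_le; apply/andP; split.
      by have := M_le 0 K0; rewrite addr0 subr0 N0.
    apply: le_M => y a Kya; have := @values_lb 0 (N (0 + y) - a).
    by rewrite oppr0 N0 oppr0; apply; exists y, a.
  apply/eqP; rewrite eq_le M_scale_le//= -ler_pdivlMl//.
  rewrite (le_trans _ (M_scale_le _ _)) ?invr_gt0// scalerA mulVf ?scale1r//.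
  by rewrite gt_eqF.
- by move=> v; have := M_le v K0; rewrite addr0 subr0.
- by move=> y a Kya; have := M_le (- y) Kya; rewrite addNr N0 sub0r.
Qed.

End Shrink.

Section MazurOrlicz.
Context {R : realType} {n : nat}.
Implicit Types (N : 'cV[R]_n -> R).

(** The constraint p x >= N x and its multiples: a minorant p of N that meets it
    touches N at x. *)
Lemma ray_minorant_cone {V : lmodType R} (N : V -> R) (x : V) : sublinear N ->
  minorant_cone N (fun y a => exists2 t, 0 <= t & y = t *: x /\ a = t * N x).
Proof.
move=> sN; split.
- by exists 0; rewrite // scale0r mul0r.
- move=> y a z b [t t0 [-> ->]] [s s0 [-> ->]]; exists (t + s).
    by rewrite addr_ge0.
  by rewrite scalerDl mulrDl.
- move=> s y a s0 [t t0 [-> ->]]; exists (s * t).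
    by rewrite mulr_ge0// ltW.
  by rewrite scalerA mulrA.
- by move=> y a [t t0 [-> ->]]; rewrite sN.2.
Qed.

(** Shrinking along one vector after the other makes N odd along each of them,
    and this survives later shrinkings; a sublinear function that is odd along
    a basis is linear. *)
Lemma sublinear_linear_minorant N : sublinear N ->
  exists p, forall v, dotv p v <= N v.
Proof.
move=> sN.
have [M [sM MN odd]] : exists M, [/\ sublinear M, forall v, M v <= N v &
    forall i : 'I_n, M (- delta_mx i 0) <= - M (delta_mx i 0)].
  suff [M [sM MN odd]] : exists M, [/\ sublinear M, forall v, M v <= N v &
      forall i, i \in enum 'I_n -> M (- delta_mx i 0) <= - M (delta_mx i 0)].
    by exists M; split => // i; apply: odd; rewrite mem_enum.
  elim: (enum 'I_n) => [|i s [M [sM MN odd]]]; first by exists N.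
  have [L [sL LM oddL]] := sublinear_shrink sM (ray_minorant_cone (delta_mx i 0) sM).
  exists L; split => // [v|j].
    exact: le_trans (LM v) (MN v).
  rewrite in_cons => /predU1P[->|js].
    apply: le_trans (oddL (delta_mx i 0) (M (delta_mx i 0)) _) _.
      by exists 1; rewrite // scale1r mul1r.
    by rewrite lerN2.
  by rewrite (le_trans (LM _))// (le_trans (odd _ js))// lerN2.
have Msum (s : seq 'I_n) (c : 'I_n -> 'cV[R]_n) :
    M (\sum_(i <- s) c i) <= \sum_(i <- s) M (c i).
  elim/big_rec2: _ => [|i y w _ ih]; first by rewrite -(scale0r 0) sM.2// mul0r.
  by rewrite (le_trans (sM.1 _ _))// lerD2l.
have Mdelta (i : 'I_n) a : M (a *: delta_mx i 0) <= a * M (delta_mx i 0).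
  have [a0|a0] := leP 0 a; first by rewrite sM.2.
  have Na0 : 0 <= - a by rewrite oppr_ge0 ltW.
  have -> : a *: delta_mx i 0 = (- a) *: (- delta_mx i 0) :> 'cV[R]_n.
    by rewrite scalerN scaleNr opprK.
  by rewrite sM.2// -[leRHS]mulrNN ler_wpM2l.
pose p : 'cV[R]_n := \col_i M (delta_mx i 0).
have Mp v : M v <= dotv p v.
  rewrite [in leLHS](col_sum_delta v) (le_trans (Msum _ _))// ler_sum// => i _.
  by rewrite mxE mulrC.
exists p => v; apply: le_trans (MN v).
have := Mp (- v); rewrite dotvNr.
have := sM.1 v (- v); rewrite subrr -(scale0r 0) sM.2// mul0r.
lra.
Qed.

(** The finite-dimensional Hahn-Banach theorem, in the form of Mazur and
    Orlicz. *)
Lemma mazur_orlicz N K : sublinear N -> minorant_cone N K ->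
  exists p, (forall v, dotv p v <= N v) /\ (forall y a, K y a -> a <= dotv p y).
Proof.
move=> sN cK; have [M [sM MN MK]] := sublinear_shrink sN cK.
have [p pM] := sublinear_linear_minorant sM.
exists p; split => [v|y a Kya]; first exact: le_trans (pM v) (MN v).
by rewrite -lerN2 -dotvNr (le_trans (pM _))// MK.
Qed.

End MazurOrlicz.

(** * Seminorms and their subgradients *)

Definition seminorm {R : realType} {V : lmodType R} (N : V -> R) :=
  (forall a u, N (a *: u) = `|a| * N u) /\
  (forall u v, N (u + v) <= N u + N v).

Section Seminorm.
Context {R : realType} {V : lmodType R} (N : V -> R).
Hypothesis sN : seminorm N.

Lemma seminorm_sublinear : sublinear N.
Proof. by split=> [|t v t0]; [exact: sN.2|rewrite sN.1 ger0_norm]. Qed.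

Lemma seminorm0 : N 0 = 0.
Proof. by rewrite -(scale0r 0) sN.1 normr0 mul0r. Qed.

Lemma seminormN u : N (- u) = N u.
Proof. by rewrite -scaleN1r sN.1 normrN1 mul1r. Qed.

Lemma seminorm_ge0 u : 0 <= N u.
Proof. have := sN.2 u (- u); rewrite subrr seminorm0 seminormN; lra. Qed.

Lemma seminorm_dist u v : `|N u - N v| <= N (u - v).
Proof.
rewrite ler_norml; have := sN.2 (u - v) v; have := sN.2 (v - u) u.
rewrite !subrK -(opprB u v) seminormN; lra.
Qed.

Lemma seminormZ c : 0 <= c -> seminorm (fun v => c * N v).
Proof.
move=> c0; split=> [a u|u v]; first by rewrite sN.1 mulrCA.
by rewrite -mulrDr ler_wpM2l// sN.2.
Qed.

Lemma seminorm_convex u v t : 0 <= t -> t <= 1 ->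
  N (u + t *: (v - u)) <= (1 - t) * N u + t * N v.
Proof.
move=> t0 t1; have -> : u + t *: (v - u) = (1 - t) *: u + t *: v.
  by rewrite scalerBr scalerBl scale1r addrCA addrC addrAC.
by rewrite (le_trans (sN.2 _ _))// !sN.1 !ger0_norm// subr_ge0.
Qed.

End Seminorm.

Section Subgradients.
Context {R : realType} {n : nat}.
Implicit Types (J H N : 'cV[R]_n -> R) (p x : 'cV[R]_n).

(** Testing the subgradient inequality at 0 and at 2 x gives <p, x> = N x, which
    decouples it from x. *)
Lemma subdifferential_seminormP N x p : seminorm N ->
  subdifferential setT N x p <-> (forall v, dotv p v <= N v) /\ dotv p x = N x.
Proof.
move=> sN; split=> [pN|[pN px] v _]; last first.
  by rewrite dotvDr dotvNr px addrCA subrr addr0.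
have px : dotv p x = N x.
  have := pN 0 I; have := pN (2 *: x) I.
  rewrite sN.1 ger0_norm// (seminorm0 sN) !(dotvDr, dotvNr, dotvZr, dotv0); lra.
split=> // v; have := pN v I; rewrite dotvDr dotvNr px; lra.
Qed.

Lemma subdifferential_nonempty N x : seminorm N ->
  exists p, subdifferential setT N x p.
Proof.
move=> sN; have subN := seminorm_sublinear sN.
have [p [pN px]] := mazur_orlicz subN (ray_minorant_cone x subN).
exists p; apply/(subdifferential_seminormP _ _ sN); split => //.
apply/eqP; rewrite eq_le pN; apply: px.
by exists 1; rewrite // scale1r mul1r.
Qed.

(** The Moreau-Rockafellar sum rule: [mazur_orlicz] provides a linear p between
    the concave P - H and the convex J, and h = P - p. *)
Lemma subdifferential_sum J H x (P : 'cV[R]_n) : seminorm J -> seminorm H ->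
  subdifferential setT (fun v => J v + H v) x P ->
  exists p h, [/\ subdifferential setT J x p, subdifferential setT H x h
                & P = p + h].
Proof.
move=> sJ sH; have sJH : seminorm (fun v => J v + H v).
  split=> [a u|u v]; first by rewrite sJ.1 sH.1 mulrDr.
  by rewrite addrACA lerD ?sJ.2 ?sH.2.
move=> /(subdifferential_seminormP _ _ sJH)[PJH Px].
have [|p [pJ pP]] :=
    @mazur_orlicz _ _ J (fun y a => a <= dotv P y - H y) (seminorm_sublinear sJ).
  split.
  - by rewrite dotv0 (seminorm0 sH) subrr.
  - by move=> y a z b ya zb; have := sH.2 y z; rewrite dotvDr; lra.
  - move=> t y a t0 ya; rewrite dotvZr sH.1 gtr0_norm// -mulrBr.
    by rewrite ler_pM2l.
  - by move=> y a /le_trans; apply; rewrite lerBlDr.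
have hH v : dotv (P - p) v <= H v.
  by have := pP v _ (lexx _); rewrite dotvDl dotvNl; lra.
exists p, (P - p); split; last by rewrite addrC subrK.
- apply/(subdifferential_seminormP _ _ sJ); split=> //.
  by have := pJ x; have := hH x; rewrite dotvDl dotvNl; lra.
- apply/(subdifferential_seminormP _ _ sH); split=> //.
  by have := pJ x; have := hH x; rewrite dotvDl dotvNl; lra.
Qed.

Lemma subgradient_coord_le N x p i : seminorm N -> subdifferential setT N x p ->
  `|p i 0| <= N (delta_mx i 0).
Proof.
move=> sN /(subdifferential_seminormP _ _ sN)[pN _].
rewrite -dotv_delta ler_norml; have := pN (delta_mx i 0).
have := pN (- delta_mx i 0); rewrite dotvNr (seminormN sN); lra.
Qed.

End Subgradients.

(** * Homogeneous convex functionals on a domain *)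

(** A set stable under all scalings contains every point as soon as it
    contains a ball around 0. *)
Lemma homogeneous_domain_setT {R : realType} {n : nat} (Omega : set 'cV[R]_n)
    (F : 'cV[R]_n -> R) :
  domain Omega -> abs_one_homogeneous Omega F -> Omega = setT.
Proof.
move=> [oO _ [w Ow]] hF; apply/seteqP; split=> // v _.
have O0 : Omega 0 by rewrite -(scale0r w); exact: (hF 0 w Ow).1.
have : nbhs (0 : 'cV[R]_n) Omega by exact: open_nbhs_nbhs.
move=> /nbhs_ballP[e /= e0 eO].
have v1 : 0 < `|v| + 1 by rewrite ltr_wpDl.
pose c := e / (2 * (`|v| + 1)).
have c0 : 0 < c by rewrite divr_gt0// mulr_gt0.
have : Omega (c *: v).
  apply: eO; rewrite -ball_normE /= sub0r normrN normrZ gtr0_norm//.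
  rewrite /c mulrAC ltr_pdivrMr ?mulr_gt0// ltr_pM2l//; lra.
move=> /(hF c^-1)[+ _]; rewrite scalerA mulVf ?scale1r//.
by rewrite gt_eqF.
Qed.

Lemma seminorm_of_convex {R : realType} {n : nat} (F : 'cV[R]_n -> R) :
  abs_one_homogeneous setT F -> convex_on setT F -> seminorm F.
Proof.
move=> hF [_ cF]; split=> [a u|u v]; first by rewrite (hF a u I).2.
have half : (0 <= (2^-1 : R) <= 1) by apply/andP; split; lra.
have := cF (Itv01 (andP half).1 (andP half).2) u v (mem_setT _) (mem_setT _).
rewrite convRE [X in F X]/conv /= (_ : unstable.onem 2^-1 = 2^-1); last first.
  by rewrite /unstable.onem; lra.
rewrite -scalerDr (hF _ _ I).2 ger0_norm ?(andP half).1// -mulrDr.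
by rewrite ler_pM2l// invr_gt0.
Qed.

(** * Convergence of column vectors *)

Section Convergence.
Context {R : realType} {n : nat}.

Lemma cvg_colP {T : Type} (F : set_system T) {FF : Filter F}
    (u : T -> 'cV[R]_n) (l : 'cV[R]_n) :
  u k @[k --> F] --> l <-> forall i, u k i 0 @[k --> F] --> l i 0.
Proof.
split=> [ul i|ul].
  exact: (cvg_comp _ _ ul (@coord_continuous _ _ _ i 0 l)).
apply/cvgrPdist_le => e e0; near=> k.
rewrite /Num.Def.normr/= mx_normrE (bigmax_le _ (ltW e0))//= => -[i j] _.
rewrite ord1 !mxE/=; move: i; near: k; apply: filter_forall => /= i.
exact: ((cvgrPdist_le _ _).1 (ul i)).
Unshelve. all: by end_near. Qed.

Lemma cvg_sumr {T I : Type} (F : set_system T) {FF : Filter F} (s : seq I)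
    (f : I -> T -> R) (l : I -> R) :
  (forall i, f i k @[k --> F] --> l i) ->
  \sum_(i <- s) f i k @[k --> F] --> \sum_(i <- s) l i.
Proof.
move=> fl; elim: s => [|i s ih].
  by rewrite big_nil; under eq_fun do rewrite big_nil; exact: cvg_cst.
by rewrite big_cons; under eq_fun do rewrite big_cons; exact: cvgD.
Qed.

Lemma cvg_dotv {T : Type} (F : set_system T) {FF : Filter F}
    (u v : T -> 'cV[R]_n) (a b : 'cV[R]_n) :
  u k @[k --> F] --> a -> v k @[k --> F] --> b ->
  dotv (u k) (v k) @[k --> F] --> dotv a b.
Proof.
move=> /cvg_colP ua /cvg_colP vb; apply: cvg_sumr => i; exact: cvgM.
Qed.

Lemma cvg_mulmx {m : nat} {T : Type} (F : set_system T) {FF : Filter F}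
    (A : 'M[R]_(m, n)) (u : T -> 'cV[R]_n) (l : 'cV[R]_n) (i : 'I_m) :
  u k @[k --> F] --> l -> (A *m u k) i 0 @[k --> F] --> (A *m l) i 0.
Proof.
move=> /cvg_colP ul; rewrite mxE; under eq_fun do rewrite mxE.
by apply: cvg_sumr => j; apply: cvgM; [exact: cvg_cst|exact: ul].
Qed.

(** N (l - v) is at most the sum of the |l i - v i| N e_i. *)
Lemma seminorm_continuous (N : 'cV[R]_n -> R) : seminorm N -> continuous N.
Proof.
move=> sN l; apply/(@cvgrPdist_le _ _ _ (nbhs l) (nbhs_filter l)) => e e0.
pose g (v : 'cV[R]_n) := \sum_(i < n) `|(l - v) i 0| * N (delta_mx i 0).
have Ng v : `|N l - N v| <= g v.
  apply: le_trans (seminorm_dist sN _ _) _.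
  rewrite [in leLHS](col_sum_delta (l - v)) /g.
  elim/big_rec2: _ => [|i y w _ ih]; first by rewrite (seminorm0 sN).
  by rewrite (le_trans (sN.2 _ _))// sN.1 lerD2l.
have g0 : g v @[v --> l] --> 0.
  have -> : 0 = \sum_(i < n) 0 * N (delta_mx i 0).
    by rewrite big1// => i _; rewrite mul0r.
  apply: (@cvg_sumr _ _ (nbhs l) (nbhs_filter l)) => i.
  apply: cvgM; last exact: cvg_cst.
  rewrite -(normr0 R); apply: cvg_norm.
  rewrite -(subrr (l i 0)); under eq_fun do rewrite !mxE.
  by apply: cvgB; [exact: cvg_cst|exact: coord_continuous].
apply: (@filterS _ (nbhs l) (nbhs_filter l) _ _ _ (cvgr_le 0 g0 e e0)) => v.
exact: le_trans.
Qed.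

Lemma cvg_seminorm {T : Type} (F : set_system T) {FF : Filter F}
    (N : 'cV[R]_n -> R) (u : T -> 'cV[R]_n) (l : 'cV[R]_n) :
  seminorm N -> u k @[k --> F] --> l -> N (u k) @[k --> F] --> N l.
Proof.
by move=> sN ul; exact: (cvg_comp _ _ ul (@seminorm_continuous N sN l)).
Qed.

(** Both conditions of [subdifferential_seminormP] are stable under limits. *)
Lemma subdifferential_closed (N : 'cV[R]_n -> R) (u p : nat -> 'cV[R]_n)
    (ustar pstar : 'cV[R]_n) :
  seminorm N -> (forall k, subdifferential setT N (u k) (p k)) ->
  u k @[k --> \oo] --> ustar -> p k @[k --> \oo] --> pstar ->
  subdifferential setT N ustar pstar.
Proof.
move=> sN pN uu pp.
have {}pN k := (subdifferential_seminormP _ _ sN).1 (pN k).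
apply/(subdifferential_seminormP _ _ sN); split.
  move=> v; apply: (@ler_cvg_to _ \oo _ _ (fun k => dotv (p k) v) (fun=> N v)).
  - by apply: cvg_dotv => //; exact: cvg_cst.
  - exact: cvg_cst.
  - by apply: nearW => k; exact: (pN k).1.
have pu : dotv (p k) (u k) @[k --> \oo] --> dotv pstar ustar.
  exact: cvg_dotv.
apply: (cvg_unique _ pu) => //.
rewrite (_ : (fun k => dotv (p k) (u k)) = (fun k => N (u k))).
  exact: cvg_seminorm.
by apply/funext => k; exact: (pN k).2.
Qed.

End Convergence.

Lemma cvg_increasing (f : nat -> nat) : increasing_seq f -> f k @[k --> \oo] --> \oo.
Proof.
move=> fi; have kf k : (k <= f k)%N.
  elim: k => // k ih; rewrite (leq_ltn_trans ih)//.
  by have /increasing_seqP/(_ k) := fi.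
move=> A [N _ NA]; exists N => // k /= Nk; apply: NA => /=.
exact: leq_trans Nk (kf k).
Qed.

Lemma bounded_real_subsequences {R : realType} {I : eqType} (s : seq I)
    (w : I -> nat -> R) : (forall i, exists M, forall k, `|w i k| <= M) ->
  exists2 f : nat -> nat, increasing_seq f &
    forall i, i \in s -> cvgn (fun k => w i (f k)).
Proof.
move=> bw; elim: s => [|i s [f fi fs]]; first by exists id.
have [|g gi gw] := @bolzano_weierstrass _ (fun k => w i (f k)).
  have [M wM] := bw i; exists M; split; first exact: num_real.
  by move=> x Mx k _ /=; rewrite (le_trans (wM _))// ltW.
exists (f \o g) => [a b|j]; first exact: etrans (fi _ _) (gi _ _).
rewrite in_cons => /predU1P[->//|/fs/cvg_ex[l fl]].
apply/cvg_ex; exists l.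
exact: (cvg_comp _ _ (cvg_increasing gi) fl).
Qed.

Lemma bounded_col_subsequences {R : realType} {n : nat} {I : finType}
    (w : I -> nat -> 'cV[R]_n) :
  (forall i j, exists M, forall k, `|w i k j 0| <= M) ->
  exists2 f : nat -> nat, increasing_seq f &
    exists l : I -> 'cV[R]_n, forall i, w i (f k) @[k --> \oo] --> l i.
Proof.
move=> bw.
have [|f fi fw] := @bounded_real_subsequences _ _ (enum {: I * 'I_n})
    (fun ij k => w ij.1 k ij.2 0); first by move=> ij; exact: bw.
exists f => //; exists (fun i => \col_j limn (fun k => w i (f k) j 0)) => i.
apply/cvg_colP => j; rewrite mxE.
by apply: (fw (i, j)); rewrite mem_enum.
Qed.

(** A sequence that does not tend to 0 stays away from 0 infinitely often. *)
Lemma not_cvg0_subsequence {R : realType} (h : nat -> R) :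
  ~ (h k @[k --> \oo] --> (0 : R)) ->
  exists2 f : nat -> nat, increasing_seq f &
    exists2 e, 0 < e & forall k, e <= `|h (f k)|.
Proof.
move=> nh; have [e e0 he] : exists2 e, 0 < e &
    forall N, exists2 k, (N <= k)%N & e <= `|h k|.
  apply: contrapT => H; apply: nh; apply/cvgr0Pnorm_lt => e e0.
  apply: contrapT => nH; apply: H; exists e => // N.
  apply: contrapT => nk; apply: nH; exists N => // k /= Nk.
  by rewrite ltNge; apply/negP => ek; apply: nk; exists k.
have [g gP] := @choice _ _ (fun N k => (N <= k)%N /\ e <= `|h k|)
  (fun N => let: ex_intro2 k a b := he N in ex_intro _ k (conj a b)).
pose f k := iter k (fun m => g m.+1) (g 0%N).
exists f.
  by apply/increasing_seqP => k; exact: (gP (f k).+1).1.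
by exists e => // -[|k]; exact: (gP _).2.
Qed.

(** * The optimality condition of one step *)

Section Step.
Context {R : realType} {m n : nat}.
Variables (J H : 'cV[R]_n -> R) (A : 'M[R]_(m, n)) (f : 'cV[R]_m).
Variables (lambda beta : R).
Hypotheses (sJ : seminorm J) (sH : seminorm H).
Hypotheses (lambda0 : 0 < lambda) (beta0 : 0 < beta).
Implicit Types (u v w x q a p : 'cV[R]_n).

(** The quadratic terms of the objective, with their gradient and half their
    second derivative in the direction d. *)
Definition smooth_part w v : R :=
  beta / 2 * norm2 (v - w) ^+ 2 + lambda / 2 * norm2 (A *m v - f) ^+ 2.

Definition smooth_gradient w x : 'cV[R]_n :=
  beta *: (x - w) + lambda *: (A^T *m (A *m x - f)).

Definition smooth_curvature d : R :=
  beta / 2 * dotv d d + lambda / 2 * dotv (A *m d) (A *m d).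

Lemma smooth_part_expand w x d t :
  smooth_part w (x + t *: d) =
  smooth_part w x + t * dotv (smooth_gradient w x) d
  + t ^+ 2 * smooth_curvature d.
Proof.
rewrite /smooth_part /smooth_gradient /smooth_curvature !norm2_sqr.
rewrite (addrAC x) (mulmxDr A x) -scalemxAr (addrAC (A *m x)).
move: (x - w) (A *m x - f) => a b.
rewrite !(dotvDl, dotvDr, dotvZl, dotvZr) dotv_trmx.
rewrite (dotvC d a) (dotvC (A *m d) b); by field.
Qed.

Lemma smooth_curvature_ge0 d : 0 <= smooth_curvature d.
Proof.
have dotv_ge0 k (e : 'cV[R]_k) : 0 <= dotv e e by rewrite -norm2_sqr sqr_ge0.
by rewrite addr_ge0// mulr_ge0// divr_ge0// ltW.
Qed.

Lemma ge0_of_small_perturbation (b C t0 : R) : 0 < t0 ->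
  (forall t, 0 < t -> t <= t0 -> 0 <= b + t * C) -> 0 <= b.
Proof.
move=> t00 h; apply/ler_addgt0Pr => e e0.
pose t := Num.min t0 (e / (`|C| + 1)).
have C1 : 0 < `|C| + 1 by rewrite ltr_wpDl.
have tp : 0 < t by rewrite lt_min t00 divr_gt0.
have te : t * (`|C| + 1) <= e by rewrite -ler_pdivlMr// ge_min lexx orbT.
have := h t tp; rewrite ge_min lexx => /(_ isT).
have : t * C <= t * `|C| by rewrite ler_wpM2l ?(ltW tp)// ler_norm.
nra.
Qed.

Section Minimiser.
Variables (w x a : 'cV[R]_n).
Hypothesis Hx : 0 < H x.
Hypothesis xmin : forall v, 0 < H v ->
  (J x - dotv a x) / H x + smooth_part w x <=
  (J v - dotv a v) / H v + smooth_part w v.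

Let s := (J x - dotv a x) / H x.
Let g := smooth_gradient w x.

(** Multiplying the minimality inequality by H v removes the denominator: to
    first order at x, where it vanishes, the function
    J - <a, .> - s H + H(x) <g, . - x> is nonnegative.  It is not convex when
    s > 0, but a majorant Phi of J - <a, .> - s H that lies below its chords
    from (x, 0) suffices to pass from small steps to arbitrary v. *)
Lemma minimiser_majorant (Phi : 'cV[R]_n -> R) :
  (forall v t, 0 <= t -> t <= 1 -> Phi (x + t *: (v - x)) <= t * Phi v) ->
  (forall v, J v - dotv a v - s * H v <= Phi v) ->
  forall v, 0 <= Phi v + H x * dotv g (v - x).
Proof.
move=> cPhi JPhi v; pose d := v - x; pose G := dotv g d.
pose Q := smooth_curvature d.
have Hd0 : 0 <= H d := seminorm_ge0 sH d.
have Q0 : 0 <= Q := smooth_curvature_ge0 d.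
(* For t <= t0 the point x + t d keeps t * H d < H x, hence H > 0 there. *)
pose t0 := Num.min 1 (H x / (H d + 1) / 2).
have Hd1 : 0 < H d + 1 by rewrite ltr_wpDl.
have t00 : 0 < t0 by rewrite lt_min ltr01 !divr_gt0.
apply: (@ge0_of_small_perturbation _ (H d * `|G| + (H x + H d) * Q) t0) => //.
move=> t tp tt0.
have t1 : t <= 1 by rewrite (le_trans tt0)// ge_min lexx.
have tHd : t * H d < H x.
  have : t * (H d + 1) <= H x / 2.
    by rewrite -ler_pdivlMr// mulrAC (le_trans tt0)// ge_min lexx orbT.
  by have := Hx; nra.
pose y := x + t *: d.
have [yl yu] : H x - t * H d <= H y /\ H y <= H x + t * H d.
  have := seminorm_dist sH y x; rewrite /y addrAC subrr add0r sH.1 (gtr0_norm tp).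
  by rewrite ler_norml => /andP[? ?]; split; lra.
have Hy : 0 < H y by rewrite (lt_le_trans _ yl)// subr_gt0.
have : 0 <= t * (Phi v + H y * (G + t * Q)).
  have := xmin Hy; rewrite -/s /y smooth_part_expand -/y -/G -/Q => h.
  have {}h : s * H y <= J y - dotv a y + (t * G + t ^+ 2 * Q) * H y.
    rewrite -[J y - _](@divfK _ (H y)) ?gt_eqF// -mulrDl ler_wpM2r ?(ltW Hy)//.
    by move: h; lra.
  have := JPhi y; have := cPhi v t (ltW tp) t1; rewrite -/d -/y.
  nra.
rewrite pmulr_rge0// => h; apply: (le_trans h).
rewrite -addrA lerD2l.
have GG : G <= `|G| := ler_norm G.
have GG' : - `|G| <= G by rewrite lerNl -normrN ler_norm.
have tQ : 0 <= t * Q by rewrite mulr_ge0// ltW.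
have h1 : H y * (t * Q) <= (H x + H d) * (t * Q).
  rewrite ler_wpM2r//; nra.
have h2 : (H y - H x) * G <= t * H d * `|G|.
  rewrite (le_trans (ler_norm _))// normrM ler_wpM2r// ler_norml.
  by apply/andP; split; lra.
rewrite -/d -/G; lra.
Qed.

(** For s < 0 the function J + |s| H is convex and the sum rule splits its
    subgradient; for s >= 0 the concave part - s H is linearised from above. *)
Lemma minimiser_optimality : exists p h,
  [/\ subdifferential setT J x p, subdifferential setT H x h
    & p = a + s *: h - H x *: g].
Proof.
have sHx : s * H x = J x - dotv a x by rewrite /s divfK// gt_eqF.
have seg v t : x + t *: (v - x) = (1 - t) *: x + t *: v.
  by rewrite scalerBr scalerBl scale1r addrCA addrC addrAC.
have [s0|s0] := leP 0 s.
  have [h hx] := subdifferential_nonempty x sH.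
  exists (a + s *: h - H x *: g), h; split => //.
  have [hH hxx] := (subdifferential_seminormP _ _ sH).1 hx.
  pose Phi v := J v - dotv a v - s * dotv h v.
  have cPhi v t : 0 <= t -> t <= 1 -> Phi (x + t *: (v - x)) <= t * Phi v.
    move=> t0 t1; rewrite /Phi; have := seminorm_convex sJ x v t0 t1.
    rewrite seg !(dotvDr, dotvZr) hxx; have := sHx.
    move: (s * H x) => sHX; nra.
  have JPhi v : J v - dotv a v - s * H v <= Phi v by rewrite lerB// ler_wpM2l.
  move=> v _; have := minimiser_majorant cPhi JPhi v; rewrite /Phi.
  rewrite !(dotvDl, dotvDr, dotvNl, dotvNr, dotvZl) hxx.
  have := sHx; lra.
have [p [h' [px hx Pe]]] : exists p h', [/\ subdifferential setT J x p,
    subdifferential setT (fun v => - s * H v) x h' & a - H x *: g = p + h'].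
  apply: subdifferential_sum => //.
    by apply: seminormZ => //; rewrite oppr_ge0 ltW.
  pose Phi v := J v - dotv a v - s * H v.
  have cPhi v t : 0 <= t -> t <= 1 -> Phi (x + t *: (v - x)) <= t * Phi v.
    move=> t0 t1; rewrite /Phi; have := seminorm_convex sJ x v t0 t1.
    have := seminorm_convex sH x v t0 t1.
    rewrite seg !(dotvDr, dotvZr); have := sHx; have := s0.
    nra.
  move=> v _; have := minimiser_majorant cPhi (fun=> lexx _) v; rewrite /Phi.
  rewrite !(dotvDl, dotvDr, dotvNl, dotvNr, dotvZl).
  have := sHx; lra.
have Ns0 : 0 < - s by rewrite oppr_gt0.
exists p, ((- s)^-1 *: h'); split => //.
- move=> v /hx; rewrite dotvZl => h.
  by rewrite -(ler_pM2l Ns0) mulrDr mulrA mulfV ?gt_eqF// mul1r.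
- rewrite scalerA invrN mulrN mulfV ?lt_eqF// scaleN1r.
  by rewrite addrAC Pe addrK.
Qed.

End Minimiser.

(** Since <q, x> <= H x, the second term of the objective is at least - R(w) at x,
    and it equals - R(w) at the competitor w. *)
Lemma objective_descent w q x : w = 0 \/ H w != 0 ->
  subdifferential setT H w q ->
  is_argmin (admissible setT H) (objective J H A f lambda beta w q) x ->
  beta / 2 * norm2 (x - w) ^+ 2 + quotient J H x
    + lambda / 2 * norm2 (A *m x - f) ^+ 2 <=
  quotient J H w + lambda / 2 * norm2 (A *m w - f) ^+ 2.
Proof.
move=> wadm qw [xadm xmin].
have quotient_ge0 v : 0 <= quotient J H v.
  by rewrite /quotient; case: ifP => // _; rewrite divr_ge0 ?seminorm_ge0.
have [qH qww] := (subdifferential_seminormP _ _ sH).1 qw.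
have objw : objective J H A f lambda beta w q w =
    lambda / 2 * norm2 (A *m w - f) ^+ 2.
  have qw1 : quotient J H w / H w * dotv q w = quotient J H w.
    rewrite qww; case: wadm => [->|Hw]; last by rewrite divfK.
    by rewrite /quotient eqxx !mul0r.
  by rewrite /objective qw1 subrr norm2_sqr dotv0; lra.
have := xmin w (conj I wadm); rewrite objw /objective.
have : quotient J H w / H x * dotv q x <= quotient J H w.
  have [->|Hx] := eqVneq (H x) 0; first by rewrite invr0 mulr0 mul0r.
  have Hx0 : 0 < H x by rewrite lt_def Hx seminorm_ge0.
  rewrite -mulrA -[leRHS]mulr1 ler_wpM2l// mulrC ler_pdivrMr// mul1r.
  exact: qH.
lra.
Qed.

Lemma argmin_optimality w q x : x != 0 ->
  is_argmin (admissible setT H) (objective J H A f lambda beta w q) x ->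
  let a := quotient J H w *: q in
  exists p h, [/\ subdifferential setT J x p, subdifferential setT H x h
    & p = a + ((J x - dotv a x) / H x) *: h - H x *: smooth_gradient w x].
Proof.
move=> x0 [[_ xadm] xmin] a.
have Hx : 0 < H x.
  by rewrite lt_def seminorm_ge0// andbT; case: xadm => // /eqP; rewrite (negPf x0).
have objE v : 0 < H v -> objective J H A f lambda beta w q v =
    (J v - dotv a v) / H v + smooth_part w v.
  move=> Hv; have v0 : v != 0.
    by apply: contraTneq Hv => ->; rewrite (seminorm0 sH) ltxx.
  rewrite /objective /smooth_part /a dotvZl /(quotient _ _ v) (negPf v0); lra.
apply: minimiser_optimality => // v Hv.
rewrite -!objE//; apply: xmin; split=> //; right.
by rewrite gt_eqF.
Qed.

End Step.

(** * The limit of the iterates *)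

Section Scheme.
Context {R : realType} {m n : nat}.
Variables (J H : 'cV[R]_n -> R) (A : 'M[R]_(m, n)) (f : 'cV[R]_m).
Variables (lambda beta : R).
Hypotheses (sJ : seminorm J) (sH : seminorm H).
Hypotheses (lambda0 : 0 < lambda) (beta0 : 0 < beta).

Lemma quotient_seminormE v : quotient J H v = J v / H v.
Proof.
by rewrite /quotient; case: eqP => // ->; rewrite (seminorm0 sJ) mul0r.
Qed.

(** The energy R(u k) + lambda/2 |A u k - f|^2 is nonincreasing and bounded
    below, hence its decrements, which dominate |u k.+1 - u k|^2, vanish. *)
Lemma iterates_gap (u q : nat -> 'cV[R]_n) :
  implicit_scheme setT J H A f lambda beta u q ->
  u k.+1 - u k @[k --> \oo] --> (0 : 'cV[R]_n).
Proof.
move=> [[_ u0adm] qH umin].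
have uadm k : u k = 0 \/ H (u k) != 0 by case: k => // k; exact: (umin k).1.2.
pose E k := quotient J H (u k) + lambda / 2 * norm2 (A *m u k - f) ^+ 2.
have descent k : beta / 2 * norm2 (u k.+1 - u k) ^+ 2 <= E k - E k.+1.
  have := objective_descent sJ sH (uadm k) (qH k) (umin k); rewrite /E; lra.
have E0 k : 0 <= E k.
  apply: addr_ge0; first by rewrite quotient_seminormE divr_ge0// seminorm_ge0.
  by apply: mulr_ge0; [rewrite divr_ge0// ltW|exact: sqr_ge0].
have Edec k : E k.+1 <= E k.
  rewrite -subr_ge0; apply: le_trans (descent k).
  by apply: mulr_ge0; [rewrite divr_ge0// ltW|exact: sqr_ge0].
have /cvg_ex[l El] : cvgn E.
  apply: nonincreasing_is_cvgn; first exact/nonincreasing_seqP.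
  by exists 0 => _ [k _ <-].
have dE0 : E k - E k.+1 @[k --> \oo] --> 0.
  by rewrite -(subrr l); apply: cvgB => //; rewrite (cvg_shiftS E).
apply/cvg_colP => i; rewrite mxE; apply/cvgr0Pnorm_le => e e0.
have be : 0 < beta / 2 * e ^+ 2 by rewrite mulr_gt0 ?exprn_gt0// divr_gt0.
apply: filterS (cvgr_le _ dE0 _ be) => k; move/(le_trans (descent k)).
rewrite ler_pM2l ?divr_gt0// ler_pXn2r ?nnegrE ?sqrtr_ge0 ?(ltW e0)//.
exact: le_trans (coord_le_norm2 _ _).
Qed.

(** In the limit the term of the optimality condition that carries the
    subgradient h of the denominator disappears: its factor tends to
    (J ustar - R(ustar) <qstar, ustar>) / H ustar = 0. *)
Lemma optimality_limit (w x q p h : nat -> 'cV[R]_n)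
    (ustar qstar pstar hstar : 'cV[R]_n) :
  w k @[k --> \oo] --> ustar -> x k @[k --> \oo] --> ustar ->
  q k @[k --> \oo] --> qstar -> p k @[k --> \oo] --> pstar ->
  h k @[k --> \oo] --> hstar ->
  subdifferential setT H ustar qstar -> H ustar != 0 ->
  (forall k, x k != 0 -> let a := quotient J H (w k) *: q k in
    p k = a + ((J (x k) - dotv a (x k)) / H (x k)) *: h k
          - H (x k) *: smooth_gradient A f lambda beta (w k) (x k)) ->
  0 = lambda *: (A^T *m (A *m ustar - f))
      + (H ustar)^-1 *: (pstar - quotient J H ustar *: qstar).
Proof.
move=> wu xu qu pu hu /(subdifferential_seminormP _ _ sH)[_ qHu] Hu opt.
have Ru : quotient J H (w k) @[k --> \oo] --> quotient J H ustar.
  under eq_fun do rewrite quotient_seminormE; rewrite quotient_seminormE.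
  by apply: cvgM; [exact: cvg_seminorm|apply: cvgV => //; exact: cvg_seminorm].
have su : (J (x k) - quotient J H (w k) * dotv (q k) (x k)) / H (x k)
    @[k --> \oo] --> 0.
  rewrite [X in _ --> X](_ : 0 =
    (J ustar - quotient J H ustar * dotv qstar ustar) / H ustar); last first.
    by rewrite qHu quotient_seminormE divfK// subrr mul0r.
  apply: cvgM; last by apply: cvgV => //; exact: cvg_seminorm.
  apply: cvgB; first exact: cvg_seminorm.
  by apply: cvgM => //; exact: cvg_dotv.
have xn0 : \forall k \near \oo, x k != 0.
  have Hup : 0 < H ustar by rewrite lt_def Hu seminorm_ge0.
  apply: filterS (cvgr_gt _ (cvg_seminorm sH xu) _ Hup) => k.
  by apply: contraTneq => ->; rewrite (seminorm0 sH) ltxx.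
have plim i : pstar i 0 = quotient J H ustar * qstar i 0 + 0 * hstar i 0
    - H ustar * (beta * (ustar i 0 - ustar i 0)
                 + lambda * (A^T *m (A *m ustar - f)) i 0).
  have pi : p k i 0 @[k --> \oo] --> pstar i 0 by move/cvg_colP: pu; exact.
  apply: (cvg_unique _ pi) => //.
  pose c k := quotient J H (w k) * q k i 0
    + (J (x k) - quotient J H (w k) * dotv (q k) (x k)) / H (x k) * h k i 0
    - H (x k) * (beta * (x k i 0 - w k i 0)
                 + lambda * (A^T *m (A *m x k - f)) i 0).
  have ceq : {near \oo, c =1 (fun k => p k i 0)}.
    by apply: filterS xn0 => k xk0; rewrite (opt k xk0) /c !mxE dotvZl.
  apply: cvg_trans (near_eq_cvg ceq) _.
  have coord (v : nat -> 'cV[R]_n) (l : 'cV[R]_n) :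
      v k @[k --> \oo] --> l -> v k i 0 @[k --> \oo] --> l i 0.
    by move/cvg_colP; exact.
  apply: cvgB; first apply: cvgD.
  - by apply: cvgM => //; exact: coord.
  - by apply: cvgM => //; exact: coord.
  apply: cvgM; first exact: cvg_seminorm.
  apply: cvgD; apply: cvgM; try exact: cvg_cst.
    by apply: cvgB; exact: coord.
  apply: cvg_mulmx; apply: cvgB; last exact: cvg_cst.
  by apply/cvg_colP => j; exact: cvg_mulmx.
move: (A^T *m _) plim => g plim.
apply/matrixP => i j; rewrite ord1.
have := plim i; rewrite subrr mulr0 mul0r addr0 add0r => pE.
by rewrite !mxE pE; field.
Qed.

End Scheme.

(** * Convergence of the scheme *)

(* The subgradients of J do not enter the scheme; they are produced by its
   optimality conditions, in which p k.+1 (at u k.+1) is paired with the q k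
   (at u k) of the same step.  Both u (phi k) and u (phi k).+1 tend to ustar.
   The last line requires H ustar != 0 in order to make sense; ustar can be so
   chosen exactly when H (u k) does not tend to 0. *)
Theorem theorem3 (R : realType) (m n : nat) (Omega : set 'cV[R]_n)
    (J H : 'cV[R]_n -> R) (A : 'M[R]_(m, n)) (f : 'cV[R]_m) (lambda beta : R)
    (u q : nat -> 'cV[R]_n)
    (hOmega : domain Omega)
    (hJhom : abs_one_homogeneous Omega J) (hHhom : abs_one_homogeneous Omega H)
    (hJcvx : convex_on Omega J) (hHcvx : convex_on Omega H)
    (hJlsc : lsc_on Omega J) (hHlsc : lsc_on Omega H)
    (hlambda : 0 < lambda) (hbeta : 0 < beta)
    (hscheme : implicit_scheme Omega J H A f lambda beta u q)
    (hbounded : exists M : R, forall k : nat, norm2 (u k) <= M) :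
  exists p : nat -> 'cV[R]_n,
    (forall k, subdifferential Omega J (u k) (p k)) /\
    exists (phi : nat -> nat) (ustar pstar qstar : 'cV[R]_n),
      {homo phi : i j / (i < j)%N} /\
      [/\ u (phi k) @[k --> \oo] --> ustar,
          u (phi k).+1 @[k --> \oo] --> ustar,
          p (phi k).+1 @[k --> \oo] --> pstar
        & q (phi k) @[k --> \oo] --> qstar] /\
      [/\ subdifferential Omega J ustar pstar,
          subdifferential Omega H ustar qstar
        & ~ (H (u k) @[k --> \oo] --> (0 : R)) ->
          H ustar != 0 /\
          0 = lambda *: (A^T *m (A *m ustar - f))
              + (H ustar)^-1 *: (pstar - quotient J H ustar *: qstar)].
Proof.
have OT := homogeneous_domain_setT hOmega hJhom.
move: hJhom hHhom hJcvx hHcvx hscheme {hJlsc hHlsc hOmega}; rewrite {}OT.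
move=> hJhom hHhom hJcvx hHcvx hscheme.
have sJ := seminorm_of_convex hJhom hJcvx.
have sH := seminorm_of_convex hHhom hHcvx.
have [_ qH umin] := hscheme.
have gap := iterates_gap sJ sH hlambda hbeta hscheme.
have [p0 p0J] := subdifferential_nonempty (u 0%N) sJ.
(* At u k.+1 = 0 the quotient has no optimality condition, and any subgradients
   will do. *)
have /choice[ph phP] : forall k, exists ph : 'cV[R]_n * 'cV[R]_n,
    [/\ subdifferential setT J (u k.+1) ph.1, subdifferential setT H (u k.+1) ph.2
    & u k.+1 != 0 -> let a := quotient J H (u k) *: q k in
      ph.1 = a + ((J (u k.+1) - dotv a (u k.+1)) / H (u k.+1)) *: ph.2
             - H (u k.+1) *: smooth_gradient A f lambda beta (u k) (u k.+1)].
  move=> k; have [u0|u0] := eqVneq (u k.+1) 0.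
    have [p pJ] := subdifferential_nonempty (u k.+1) sJ.
    have [h hH] := subdifferential_nonempty (u k.+1) sH.
    by exists (p, h).
  have [p [h [pJ hH ph]]] := argmin_optimality sJ sH hlambda hbeta u0 (umin k).
  by exists (p, h).
pose p k := if k is k'.+1 then (ph k').1 else p0.
exists p; split; first by case=> // k; have [] := phP k.
have [psi psii psiH] : exists2 psi : nat -> nat, increasing_seq psi &
    ~ (H (u k) @[k --> \oo] --> (0 : R)) ->
    exists2 e, 0 < e & forall k, e <= H (u (psi k)).
  have [H0|H0] := pselect (H (u k) @[k --> \oo] --> (0 : R)); first by exists id.
  have [psi psii [e e0 eH]] := not_cvg0_subsequence H0.
  exists psi => // _; exists e => // k.
  by rewrite (le_trans (eH k))// ger0_norm// seminorm_ge0.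
pose w (i : 'I_4) k :=
  nth (fun=> 0) [:: u; fun k => p k.+1; q; fun k => (ph k).2] i (psi k).
have [|g gi [l wl]] := @bounded_col_subsequences _ _ _ w.
  move=> [[|[|[|[|//]]]] i4] j; rewrite /w /=.
  - have [M uM] := hbounded; exists M => k.
    exact: le_trans (coord_le_norm2 _ _) (uM _).
  - exists (J (delta_mx j 0)) => k.
    by have [pJ _ _] := phP (psi k); exact: subgradient_coord_le pJ.
  - exists (H (delta_mx j 0)) => k.
    exact: subgradient_coord_le (qH _).
  - exists (H (delta_mx j 0)) => k.
    by have [_ hH _] := phP (psi k); exact: subgradient_coord_le hH.
pose phi := psi \o g.
have phii : increasing_seq phi by move=> a b; exact: etrans (psii _ _) (gi _ _).
pose c0 := @Ordinal 4 0 isT; pose c1 := @Ordinal 4 1 isT.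
pose c2 := @Ordinal 4 2 isT; pose c3 := @Ordinal 4 3 isT.
have ul : u (phi k) @[k --> \oo] --> l c0 := wl c0.
have pl : p (phi k).+1 @[k --> \oo] --> l c1 := wl c1.
have ql : q (phi k) @[k --> \oo] --> l c2 := wl c2.
have hl : (ph (phi k)).2 @[k --> \oo] --> l c3 := wl c3.
have u1l : u (phi k).+1 @[k --> \oo] --> l c0.
  rewrite -[l c0]add0r.
  under eq_fun => k do rewrite -(subrK (u (phi k)) (u (phi k).+1)).
  by apply: cvgD => //; exact: (cvg_comp _ _ (cvg_increasing phii) gap).
have qHl := subdifferential_closed sH (fun k => qH (phi k)) ul ql.
exists phi, (l c0), (l c1), (l c2); split.
  by move=> i j; rewrite (leqW_mono (phii : {mono phi : a b / (a <= b)%N})).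
split; first by split.
split => //.
  apply: (subdifferential_closed sJ _ u1l pl) => k.
  by have [] := phP (phi k).
move=> /psiH[e e0 eH].
have Hl : H (l c0) != 0.
  rewrite gt_eqF// (lt_le_trans e0)//.
  apply: (@ler_cvg_to _ \oo _ _ (fun=> e) (fun k => H (u (phi k)))).
  - exact: cvg_cst.
  - exact: cvg_seminorm.
  - by apply: nearW => k; exact: eH.
split=> //; apply: (optimality_limit (beta := beta) sJ sH ul u1l ql pl hl qHl Hl) => k.
by have [_ _] := phP (phi k).
Qed.
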